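(* Let $K$ and $n$ be positive integers. For any two $n$-compositions $\sigma$ and $\tau$ of $K$, there exists a bijection between $\overline{\mathcal{Q}}_{\mathcal{M}^{\sigma}}$ and $\overline{\mathcal{Q}}_{\mathcal{M}^{\tau}}$ which preserves the number of ascents, the number of descents and the number of plateaux. Consequently, $\overline{Q}_{\mathcal{M}^{\sigma}}(t,u,v)=\overline{Q}_{\mathcal{M}^{\tau}}(t,u,v)$.
   Context: An $n$-composition of $K$ is a sequence $\sigma=(\sigma_1,\ldots,\sigma_n)$ of positive integers with $\sigma_1+\cdots+\sigma_n=K$. $\mathcal{M}^{\sigma}=\{1^{\sigma_1},2^{\sigma_2},\ldots,n^{\sigma_n}\}$ denotes the multiset in which $i$ occurs exactly $\sigma_i$ times. A permutation of a multiset is a linear arrangement (word) of its elements in which each element is used with its multiplicity. A permutation $\pi$ of a multiset is quasi-Stirling if there do not exist indices $i<j<k<\ell$ with $\pi_i=\pi_k$ and $\pi_j=\pi_\ell$. $\overline{\mathcal{Q}}_{\mathcal{M}}$ is the set of quasi-Stirling permutations of the multiset $\mathcal{M}$. For a word $\pi=\pi_1\pi_2\cdots\pi_N$ of positive integers, with the convention $\pi_0=\pi_{N+1}=0$, an index $i$ with $0\le i\le N$ is an ascent (resp. descent, plateau) if $\pi_i<\pi_{i+1}$ (resp. $\pi_i>\pi_{i+1}$, $\pi_i=\pi_{i+1}$); $asc(\pi)$, $des(\pi)$, $plat(\pi)$ are the numbers of ascents, descents, plateaux. Finally $\overline{Q}_{\mathcal{M}}(t,u,v)=\sum_{\pi\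in\overline{\mathcal{Q}}_{\mathcal{M}}}t^{des(\pi)}u^{asc(\pi)}v^{plat(\pi)}$.
   Formalization: Quasi-Stirling is taken with the extra condition that π_i and π_j are distinct; read literally, four equal letters already violate the condition, and the claim fails for the compositions (4,1) and (3,2) of 5. *)

(* Defs.v *)
From mathcomp Require Import all_boot all_order all_algebra.
From mathcomp Require Import mpoly.

Set Implicit Arguments.
Unset Strict Implicit.
Unset Printing Implicit Defensive.

Import GRing.Theory.

(** Multisets of naturals are represented by sequences up to [perm_eq]. *)

Definition is_composition (n K : nat) (sigma : n.-tuple nat) : bool :=
  all (fun m => 0 < m) sigma && (sumn sigma == K).

(** Ordinals start at 0, letters at 1. *)
Definition comp_multiset (n : nat) (sigma : n.-tuple nat) : seq nat :=
  flatten [seq nseq (tnth sigma i) i.+1 | i : 'I_n <- enum 'I_n].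

(** The two crossing values must be distinct: otherwise a letter occurring at
    least four times would by itself rule out the word. *)
Definition quasi_stirling (w : seq nat) : bool :=
  ~~ [exists i : 'I_(size w), exists j : 'I_(size w),
      exists k : 'I_(size w), exists l : 'I_(size w),
        [&& i < j, j < k, k < l,
            nth 0 w i == nth 0 w k, nth 0 w j == nth 0 w l
          & nth 0 w i != nth 0 w j]].

(** [permutations M] lists each distinct rearrangement of [M] exactly once. *)
Definition qstirling_words (M : seq nat) : seq (seq nat) :=
  [seq w <- permutations M | quasi_stirling w].

(** [letter w i] is the i-th letter of [w], numbered from 1; it is 0 at the
    positions 0 and [(size w).+1] (the latter by the default value of [nth]). *)
Definition letter (w : seq nat) (i : nat) : nat := nth 0 (0 :: w) i.

Definition asc (w : seq nat) : nat :=
  #|[set i : 'I_(size w).+1 | letter w i < letter w i.+1]|.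

Definition des (w : seq nat) : nat :=
  #|[set i : 'I_(size w).+1 | letter w i > letter w i.+1]|.

Definition plat (w : seq nat) : nat :=
  #|[set i : 'I_(size w).+1 | letter w i == letter w i.+1]|.

(** The variables t, u, v are ['X_0], ['X_1], ['X_2]. *)
Definition qstirling_poly (M : seq nat) : {mpoly int[3]} :=
  (\sum_(w <- qstirling_words M)
     'X_(inord 0) ^+ des w * 'X_(inord 1) ^+ asc w * 'X_(inord 2) ^+ plat w)%R.

(* Main.v *)
Require Import Defs.
From mathcomp Require Import all_boot all_order all_algebra.
From mathcomp Require Import mpoly.
From mathcomp Require Import zify.

(** Prefixing a word w by its boundary letter 0 and closing it up into a circle
    turns the ascents, descents and plateaux of w into those of the cyclic word
    0w, and the quasi-Stirling condition, which says that the classes of equal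
    letters form a noncrossing partition, does not depend on where a circle is
    cut. Let a and b be consecutive positive integers occurring in such a cyclic
    word. Since the two letters do not cross, the occurrences of a form one run
    followed by one run of occurrences of b, with other letters in between; when
    a occurs twice, the cyclic word contains a factor
<<
      a s a u b
>>
    where s and u avoid a and b. The local move [shift] replaces it by
<<
      a u b s b
>>
    It trades one copy of a for one copy of b. By noncrossingness no letter of s
    occurs outside s, so moving the block s creates no crossing
    ([shift_noncrossing]). Adjacent pairs of letters are kept, except that the
    closed walk from a through s back to a becomes a closed walk at b; as a and
    b are consecutive they compare in the same way with all letters of s, so the
    three statistics are kept ([shift_cyclic_count]). The factor can be recovered
    from its image, so the move is injective ([shift_inj]).

    Hence the number of words with prescribed statistics does not decrease when
    a copy of a letter is turned into a copy of a neighbouring one; exchanging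
    the roles of a and b gives equality ([move_copy]). Such moves carry every
    composition of K into n parts to (K - n + 1, 1, ..., 1)
    ([equistat_collapse_left]), so any two of them have the same multiset of statistics,
    which gives both the bijection and the equality of polynomials. *)

(** * Splitting words at a letter *)

Section Words.
Context {T : eqType}.
Implicit Types (x y : T) (s t u v w : seq T).

Lemma split_first {x s} : x \in s -> exists s1 s2, s = s1 ++ x :: s2 /\ x \notin s1.
Proof.
elim: s => // y s IH; have [-> _|nyx] := eqVneq y x; first by exists [::], s.
rewrite inE eq_sym (negPf nyx) => /IH [s1 [s2 [-> ns]]].
by exists (y :: s1), s2; rewrite inE eq_sym (negPf nyx).
Qed.

Lemma split_last {x s} : x \in s -> exists s1 s2, s = s1 ++ x :: s2 /\ x \notin s2.
Proof.
rewrite -mem_rev => /split_first [s1 [s2 [/(canRL revK) -> ns]]].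
by exists (rev s2), (rev s1); rewrite rev_cat rev_cons cat_rcons mem_rev.
Qed.

Lemma cat_cons_inj_first {x s1 s2 t1 t2} : x \notin s1 -> x \notin t1 ->
  s1 ++ x :: s2 = t1 ++ x :: t2 -> s1 = t1 /\ s2 = t2.
Proof.
elim: s1 t1 => [|y s IH] [|z t] //=.
- by move=> _ _ [->].
- by rewrite inE => _ /norP[/eqP nxz _] [].
- by rewrite inE => /norP[/eqP nxy _] _ [/esym].
rewrite !inE => /norP[_ ns] /norP[_ nt] [-> /(IH _ ns nt) [-> ->]].
by [].
Qed.

Lemma cat_cons_inj_last {x s1 s2 t1 t2} : x \notin s2 -> x \notin t2 ->
  s1 ++ x :: s2 = t1 ++ x :: t2 -> s1 = t1 /\ s2 = t2.
Proof.
move=> ns nt /(congr1 rev); rewrite !rev_cat !rev_cons !cat_rcons.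
by case/cat_cons_inj_first; rewrite ?mem_rev // => /(can_inj revK) -> /(can_inj revK) ->.
Qed.

(** * Noncrossing words *)

Definition noncrossing w := forall x y, x != y -> ~~ subseq [:: x; y; x; y] w.

Lemma noncrossing_subseq {s t} : subseq s t -> noncrossing t -> noncrossing s.
Proof. by move=> st nt x y /nt; apply/contraNN => /subseq_trans; apply. Qed.

Lemma subseq_catP s u v :
  subseq s (u ++ v) -> exists s1 s2, [/\ s = s1 ++ s2, subseq s1 u & subseq s2 v].
Proof.
elim: u s => [|y u IH] s /=; first by exists [::], s.
case: s => [|x s] /=; first by exists [::], [::]; rewrite sub0seq.
case: eqP => [->|nxy] /IH [s1 [s2 [E s1u s2v]]].
  by exists (y :: s1), s2; rewrite E /= eqxx.
case: s1 E s1u => [|z s1] E s1u; first by exists [::], s2.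
move: E => /= [? E]; subst z; exists (x :: s1), s2; rewrite E; split => //=.
by case: eqP nxy.
Qed.

(** Cutting x y x y into two pieces and swapping them gives x y x y or y x y x,
    so a crossing survives rotation, possibly with its two letters exchanged. *)
Lemma noncrossing_catC {u v} : noncrossing (u ++ v) -> noncrossing (v ++ u).
Proof.
move=> nc x y nxy; apply/negP => /subseq_catP [s1 [s2 [E s1v s2u]]].
have := cat_subseq s2u s1v.
have nyx : y != x by rewrite eq_sym.
case: s1 E {s1v} => [|x1 [|x2 [|x3 [|x4 [|x5 s1]]]]] /=.
- by move=> <-; apply/negP/nc.
- by move=> [<- <-]; apply/negP/nc.
- by move=> [<- <- <-]; apply/negP/nc.
- by move=> [<- <- <- <-]; apply/negP/nc.
- by move=> [<- <- <- <- <-]; apply/negP/nc.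
- by [].
Qed.

Lemma subseq_notin_prefix x s u v : x \notin u ->
  subseq (x :: s) (u ++ v) = subseq (x :: s) v.
Proof. by elim: u => //= y u IH; rewrite inE => /norP[/negPf -> /IH]. Qed.

Lemma subseq_notin_suffix x s u v : x \notin v ->
  subseq (rcons s x) (u ++ v) = subseq (rcons s x) u.
Proof.
move=> nv; rewrite -subseq_rev rev_rcons rev_cat subseq_notin_prefix ?mem_rev //.
by rewrite -rev_rcons subseq_rev.
Qed.

Lemma filter_none (a : pred T) s : {in s, forall x, ~~ a x} -> filter a s = [::].
Proof.
move=> na; apply/eqP; rewrite -size_eq0 size_filter -leqn0 leqNgt -has_count.
by apply/hasPn.
Qed.

(** A crossing with both letters in the block v, or both outside it, already
    occurs in v or in u ++ w. A mixed one contains p q p with p in v and q not in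
    v; as all occurrences of p lie in v, so would the q between them. *)
Lemma noncrossing_insert {u v w} : {in v, forall x, x \notin u ++ w} ->
  noncrossing v -> noncrossing (u ++ w) -> noncrossing (u ++ v ++ w).
Proof.
move=> dis ncv ncuw.
have sandwich p q : p \in v -> q \notin v -> ~~ subseq [:: p; q; p] (u ++ v ++ w).
  move=> pv; apply/contraNN; have := dis _ pv; rewrite mem_cat => /norP[pu pw].
  rewrite subseq_notin_prefix // -[[:: p; q; p]]/(rcons [:: p; q] p).
  by rewrite subseq_notin_suffix // => /mem_subseq; apply; rewrite !inE eqxx orbT.
move=> x y nxy; apply/negP => sub.
have subf (a : pred T) : a x -> a y ->
    subseq [:: x; y; x; y] (filter a u ++ filter a v ++ filter a w).
  by move=> ax ay; rewrite -!filter_cat subseq_filter sub /= ax ay.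
have [xv|xv] := boolP (x \in v); have [yv|yv] := boolP (y \in v).
- have /negP := ncv x y nxy; apply.
  have := subf (mem v) xv yv.
  rewrite (@filter_none _ u); last first.
    by move=> z zu; apply/negP => /= /dis; rewrite mem_cat zu.
  rewrite (@filter_none _ w); last first.
    by move=> z zw; apply/negP => /= /dis; rewrite mem_cat zw orbT.
  by rewrite cats0 => /subseq_trans; apply; exact: filter_subseq.
- have /negP := sandwich x y xv yv; apply; apply: subseq_trans sub.
  exact: (subseq_rcons [:: x; y; x] y).
- have /negP := sandwich y x yv xv; apply; apply: subseq_trans sub.
  exact: subseq_cons.
have /negP := ncuw x y nxy; apply.
have := subf (predC (mem v)) xv yv.
rewrite (@filter_none _ v); last by move=> z zv /=; rewrite zv.
by move/subseq_trans; apply; apply: cat_subseq; exact: filter_subseq.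
Qed.

(** A subsequence without equal neighbours cannot use both copies of x. *)
Lemma noncrossing_double x u v :
  noncrossing (u ++ x :: v) -> noncrossing (u ++ x :: x :: v).
Proof.
move=> nc p q npq; apply: contra (nc p q npq).
have : sorted (fun y z => y != z) [:: p; q; p; q] by rewrite /= npq eq_sym npq.
elim: u {nc npq} [:: p; q; p; q] => [|y u IH] [|z s] //=.
  have [->|nzx] := eqP; last by case: eqP nzx.
    case: s => [|z' s] /=; rewrite ?sub0seq // => /andP[/negPf nz _].
    by rewrite eq_sym nz.
move=> ps; case: eqP => _; apply: IH => //=.
by case: s ps => //= ? ? /andP[].
Qed.

(** * Rotations and cyclic statistics *)

Definition is_rotation s t := exists u v, s = u ++ v /\ t = v ++ u.

Lemma is_rotation_sym {s t} : is_rotation s t -> is_rotation t s.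
Proof. by move=> [u [v [-> ->]]]; exists v, u. Qed.

Lemma is_rotationP {s t} : is_rotation s t <-> exists k, t = rot k s.
Proof.
split=> [[u [v [-> ->]]]|[k ->]]; first by exists (size u); rewrite rot_size_cat.
by exists (take k s), (drop k s); rewrite cat_take_drop.
Qed.

Lemma is_rotation_trans {s t u} :
  is_rotation s t -> is_rotation t u -> is_rotation s u.
Proof.
move=> /is_rotationP [k ->] /is_rotationP [l ->]; apply/is_rotationP.
by rewrite rot_rot_add; eexists.
Qed.

Lemma is_rotation_to {x s} : x \in s -> exists t, is_rotation s (x :: t).
Proof. by case/rot_to => k t E; exists t; apply/is_rotationP; exists k. Qed.

Lemma is_rotation_perm {s t} : is_rotation s t -> perm_eq s t.
Proof. by move=> [u [v [-> ->]]]; rewrite perm_catC. Qed.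

Lemma is_rotation_noncrossing {s t} :
  is_rotation s t -> noncrossing s -> noncrossing t.
Proof. by move=> [u [v [-> ->]]]; exact: noncrossing_catC. Qed.

(** A letter occurring only once marks the place where the circle is cut. *)
Lemma is_rotation_head_uniq {x s t} :
  x \notin s -> is_rotation (x :: s) (x :: t) -> s = t.
Proof.
move=> nxs [[|y u] [v [/= Es Et]]]; first by move: Es Et => <-; rewrite cats0 => -[].
case: v Es Et => [|z v] Es; first by rewrite cats0 in Es; rewrite -Es => -[].
move=> [? _]; subst z; move: Es => [_ E]; case/negP: nxs.
by rewrite E mem_cat inE eqxx orbT.
Qed.

Section CyclicCount.
Context (z0 : T) (r : rel T).

(** The pair formed by the last letter and the first one is counted as well. *)
Definition cyclic_count c := count id (pairmap r (last z0 c) c).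

Lemma cyclic_count_rotation {s t} : is_rotation s t -> cyclic_count s = cyclic_count t.
Proof.
move=> [[|x u] [[|y v] [-> ->]]]; rewrite ?cats0 //.
by rewrite /cyclic_count !last_cat !pairmap_cat !count_cat /= addnC.
Qed.

End CyclicCount.

End Words.

(** * Moving one copy of a letter *)

Section Shift.
Context {T : eqType} {a b : T}.
Implicit Types (x y : T) (s t u v w c d : seq T).

(** The conditions on a and b make the first b of d, the last a before it and the
    next b after it the three delimiters of the moved block. *)
Definition shift c d := exists p s u r,
  [/\ c = p ++ a :: s ++ a :: u ++ b :: r, d = p ++ a :: u ++ b :: s ++ b :: r,
      a \notin s ++ u ++ r & b \notin p ++ s ++ u].

Lemma shift_perm {c d} : shift c d -> perm_eq (b :: c) (a :: d).
Proof.
move=> [p [s [u [r [-> -> _ _]]]]]; apply/permP => e.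
by do 3!rewrite /= !count_cat; rewrite /=; lia.
Qed.

(** The block s sits between two successive occurrences of a, so a letter of s
    occurring elsewhere would cross a. Thus s can be removed and reinserted
    between two copies of b, one of them created by doubling. *)
Lemma shift_noncrossing {c d} : shift c d -> noncrossing c -> noncrossing d.
Proof.
move=> [p [s [u [r [-> -> ]]]]]; rewrite !mem_cat !negb_or.
move=> /and3P[nas nau nar] /and3P[nbp nbs nbu] nc.
rewrite (_ : p ++ _ = (p ++ a :: u ++ [:: b]) ++ s ++ b :: r); last first.
  by rewrite -!catA !cat_cons -!catA.
apply: noncrossing_insert.
- move=> y ys; have nya : a != y by apply: contraNneq nas => ->.
  have nyb : b != y by apply: contraNneq nbs => ->.
  rewrite !(mem_cat, inE) ![y == _]eq_sym (negPf nya) (negPf nyb) /= orbF.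
  have ys1 : subseq [:: y] s by rewrite sub1seq.
  rewrite -!orbA !negb_or; apply/and3P; split; apply/negP => yin.
  + have nay : y != a by rewrite eq_sym.
    have /negP := nc y a nay; apply.
    rewrite -[[:: y; a; y; a]]/([:: y] ++ a :: [:: y] ++ [:: a]).
    apply: cat_subseq; rewrite ?sub1seq //= eqxx -[[:: y; a]]/([:: y] ++ [:: a]).
    by apply: cat_subseq; rewrite // sub1seq mem_head.
  + have /negP := nc a y nya; apply.
    apply: subseq_trans (suffix_subseq _ _) => /=; rewrite eqxx.
    rewrite -[[:: y; a; y]]/([:: y] ++ [:: a; y]); apply: cat_subseq => //=.
    by rewrite eqxx sub1seq mem_cat yin.
  have /negP := nc a y nya; apply.
  apply: subseq_trans (suffix_subseq _ _) => /=; rewrite eqxx.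
  rewrite -[[:: y; a; y]]/([:: y] ++ [:: a; y]); apply: cat_subseq => //=.
  by rewrite eqxx sub1seq mem_cat inE yin !orbT.
- apply: noncrossing_subseq nc; apply: subseq_trans (suffix_subseq _ _).
  by apply: subseq_trans (subseq_cons _ _); exact: prefix_subseq.
rewrite -!catA cat_cons -catA /= -cat_cons catA.
apply/noncrossing_double; apply: noncrossing_subseq nc.
rewrite -catA; apply: cat_subseq => //; rewrite cat_cons /= eqxx.
by apply: subseq_trans (suffix_subseq _ _); exact: subseq_cons.
Qed.

(** Both words run through the same pairs of cyclic neighbours, except that the
    walk a, s, a is replaced by b, s, b. *)
Lemma shift_cyclic_count (z0 : T) (r : rel T) {c d} : r a a = r b b ->
  (forall x, x != a -> x != b -> r a x = r b x /\ r x a = r x b) ->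
  shift c d -> cyclic_count z0 r c = cyclic_count z0 r d.
Proof.
move=> raa rab [p [s [u [t [-> -> ]]]]]; rewrite !mem_cat !negb_or.
move=> /and3P[nas _ _] /and3P[_ nbs _].
have loop : count id (pairmap r a (rcons s a)) = count id (pairmap r b (rcons s b)).
  case: s nas nbs => [|y s] nas nbs; first by rewrite /= raa.
  have nin e : e \notin y :: s -> (y != e) /\ (last y s != e).
    by move=> ne; split; apply: contraNneq ne => <-; rewrite ?mem_head ?mem_last.
  have [ya la] := nin _ nas; have [yb lb] := nin _ nbs.
  rewrite /= -!cats1 !pairmap_cat !count_cat /=.
  by have [-> _] := rab _ ya yb; have [_ ->] := rab _ la lb.
move: loop; rewrite -!cats1 !pairmap_cat !count_cat /= !addn0 => loop.
rewrite /cyclic_count !(last_cat, last_cons, pairmap_cat, count_cat) /=.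
rewrite !(last_cat, last_cons, pairmap_cat, count_cat) /=.
rewrite !(last_cat, last_cons, pairmap_cat, count_cat) /=.
lia.
Qed.

(** A circle is cut at the first a of its run of a's, so that [shift] never has
    to wrap around the cut. *)
Definition canonical c := exists u v, [/\ c = a :: u ++ b :: v, b \notin u & a \notin v].

Hypothesis nab : a != b.

(** Cut at any b and then at the first a after it: in the resulting word, an a
    after a b would cross with the b that was cut first. *)
Lemma canonical_rotation_exists {c} : noncrossing c -> a \in c -> b \in c ->
  exists2 d, canonical d & is_rotation c d.
Proof.
move=> nc ac /is_rotation_to [c1 rc1].
have ac1 : a \in c1.
  by move: ac; rewrite (perm_mem (is_rotation_perm rc1)) inE (negPf nab).
have [s [t [E1 nas]]] := split_first ac1; subst c1.
have nct := is_rotation_noncrossing rc1 nc.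
exists (a :: t ++ b :: s).
  have [bt|nbt] := boolP (b \in t); last by exists t, s.
  have [t1 [t2 [E2 nbt1]]] := split_first bt; subst t.
  exists t1, (t2 ++ b :: s); rewrite -catA cat_cons; split=> //.
  rewrite mem_cat inE (negPf nab) (negPf nas) !orbF; apply/negP => at2.
  have nba : b != a by rewrite eq_sym.
  have /negP := nct b a nba; apply.
  rewrite /= eqxx; apply: subseq_trans (suffix_subseq _ _) => /=.
  rewrite eqxx; apply: subseq_trans (suffix_subseq _ _) => /=.
  by rewrite eqxx sub1seq.
apply: is_rotation_trans rc1 _; exists (b :: s), (a :: t).
by rewrite cat_cons.
Qed.

(** In a canonical word no b separates two occurrences of a; below, this makes a
    second canonical cut of the same circle impossible. *)
Lemma canonical_head_only {u v} : canonical (a :: u ++ a :: v) -> b \notin u.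
Proof.
move=> [A [B [[E] nbA naB]]]; apply/negP => /split_first [s [t [Eu nbs]]].
move: E; rewrite Eu -catA cat_cons => /(cat_cons_inj_first nbs nbA) [_ EB].
by move: naB; rewrite -EB mem_cat inE eqxx orbT.
Qed.

Lemma canonical_rotation_uniq {c d} :
  canonical c -> canonical d -> is_rotation c d -> c = d.
Proof.
move=> cc cd [[|x u] [[|y v] [Ec Ed]]]; rewrite ?cats0 /= in Ec Ed; subst => //.
have ? : x = a by case: cc => ? [? [[]]].
have ? : y = a by case: cd => ? [? [[]]].
subst; have nbu := canonical_head_only cc; have nbv := canonical_head_only cd.
case: cc => A [B [[E] _ _]]; have : b \in u ++ a :: v by rewrite E mem_cat inE eqxx orbT.
by rewrite mem_cat inE eq_sym (negPf nbu) (negPf nab) (negPf nbv).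
Qed.

Lemma shift_exists {c} : canonical c -> 1 < count_mem a c -> exists d, shift c d.
Proof.
move=> [u [v [-> nbu nav]]]; rewrite /= eqxx count_cat /= [b == a]eq_sym (negPf nab).
rewrite (count_memPn nav) !addn0 add1n ltnS -has_count has_pred1 => au.
have [q [t [E nat]]] := split_last au.
have [p [s [E' nas]]] := split_last (mem_head a q).
exists (p ++ a :: t ++ b :: s ++ b :: v), p, s, t, v; split => //.
- by rewrite E -cat_cons -cat_cons E' -!catA.
- by rewrite !mem_cat !negb_or nas nat.
move: nbu; rewrite E mem_cat inE !negb_or => /and3P[nbq _ nbt].
have : b \notin a :: q by rewrite inE negb_or eq_sym nab.
by rewrite E' !mem_cat inE !negb_or => /and3P[-> _ ->].
Qed.

Lemma shift_canonical {c d} : canonical c -> shift c d -> canonical d.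
Proof.
move=> [u [v [Ec _ _]]] [p [s [t [r [Ec' ->]]]]]; rewrite !mem_cat !negb_or.
move=> /and3P[nas nat nar] /and3P[nbp nbs nbt].
have naR : a \notin s ++ b :: r by rewrite mem_cat inE !negb_or nas nab nar.
case: p Ec' nbp => [|y p] Ec' nbp; first by exists t, (s ++ b :: r).
have ? : y = a by move: Ec'; rewrite Ec => -[].
subst y; exists (p ++ a :: t), (s ++ b :: r); split=> //; first by rewrite -catA.
move: nbp; rewrite inE mem_cat inE !negb_or => /andP[_ ->].
by rewrite eq_sym nab nbt.
Qed.

Lemma shift_inj {c1 c2 d} : shift c1 d -> shift c2 d -> c1 = c2.
Proof.
move=> [p [s [u [r [-> -> ]]]]]; rewrite !mem_cat !negb_or.
move=> /and3P[nas nau nar] /and3P[nbp nbs nbu].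
move=> [p' [s' [u' [r' [-> ]]]]]; rewrite !mem_cat !negb_or.
move=> E /and3P[nas' nau' nar'] /and3P[nbp' nbs' nbu'].
have nb q t : b \notin q -> b \notin t -> b \notin q ++ a :: t.
  by rewrite mem_cat inE eq_sym !negb_or nab => -> ->.
move: E; rewrite -cat_cons catA -[in RHS]cat_cons [in RHS]catA.
(* The word d is cut at its first b, at the last a before it, and at the next b. *)
move=> /(cat_cons_inj_first (nb _ _ nbp nbu) (nb _ _ nbp' nbu')) [].
move=> /(cat_cons_inj_last nau nau') [-> ->].
by move=> /(cat_cons_inj_first nbs nbs') [-> ->].
Qed.

End Shift.
Arguments canonical {T}.
Arguments shift {T}.

(** * Quasi-Stirling words and their statistics as cyclic data *)

Lemma subseq_drop_nth (x0 x : nat) s w k :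
  reflect (exists i, [/\ k <= i, i < size w, nth x0 w i = x & subseq s (drop i.+1 w)])
          (subseq (x :: s) (drop k w)).
Proof.
apply: (iffP idP) => [|[i [ki iw <- sub]]]; last first.
  have -> : drop k w = drop k (take i w) ++ nth x0 w i :: drop i.+1 w.
    rewrite -drop_nth // -{1}(cat_take_drop i w) drop_cat size_take iw.
    case: ltnP => // ik; have -> : k = i by apply/eqP; rewrite eqn_leq ki.
    by rewrite subnn drop0 [drop i (take i w)]drop_oversize // size_take iw.
  by apply: subseq_trans (suffix_subseq _ _); rewrite /= eqxx.
move: {-1}(drop k w) (erefl (drop k w)) => t; elim: t k => [|y t IH] k //= E.
have kw : k < size w by rewrite -subn_gt0 -size_drop E.
have [Ey Et] : nth x0 w k = y /\ drop k.+1 w = t.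
  by move: E; rewrite (drop_nth x0) // => -[].
case: eqP => [->|_] sub; first by exists k; rewrite Ey Et.
have [i [ki iw Ei si]] := IH k.+1 Et sub.
by exists i; split=> //; exact: ltnW.
Qed.

Lemma quasi_stirlingP w : reflect (noncrossing w) (quasi_stirling w).
Proof.
apply: (iffP negP) => [nq x y nxy|nc].
  apply/negP; rewrite -[w in subseq _ w]drop0.
  move=> /(subseq_drop_nth 0)[i [_ iw Ei]] /(subseq_drop_nth 0)[j [ij jw Ej]].
  move=> /(subseq_drop_nth 0)[k [jk kw Ek]] /(subseq_drop_nth 0)[l [kl lw El _]].
  apply: nq; apply/existsP; exists (Ordinal iw); apply/existsP; exists (Ordinal jw).
  apply/existsP; exists (Ordinal kw); apply/existsP; exists (Ordinal lw).
  by rewrite /= ij jk kl Ei Ej Ek El !eqxx.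
move=> /existsP[i /existsP[j /existsP[k /existsP[l /and5P[ij jk kl /eqP ik]]]]].
move=> /andP[/eqP jl nij]; have /negP := nc _ _ nij; apply.
rewrite -[X in subseq _ X]drop0; apply/(subseq_drop_nth 0); exists i; split=> //.
apply/(subseq_drop_nth 0); exists j; split=> //.
apply/(subseq_drop_nth 0); exists k; split=> //.
by apply/(subseq_drop_nth 0); exists l; rewrite sub0seq.
Qed.

Lemma card_letter_pairs (r : rel nat) w :
  #|[set i : 'I_(size w).+1 | r (letter w i) (letter w i.+1)]| =
  cyclic_count 0 r (0 :: w).
Proof.
pose P i := r (letter w i) (letter w i.+1).
rewrite -sum1dep_card -(big_mkord P (fun=> 1)) sum1_count /index_iota subn0.
rewrite -addn1 iotaD count_cat /= add0n addn0 addnC /cyclic_count /=; congr (_ + _).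
  by rewrite /P /letter /= (last_nth 0) [nth 0 w (size w)]nth_default.
have -> : pairmap r 0 w = map P (iota 0 (size w)).
  apply: (@eq_from_nth _ false) => [|i]; rewrite size_pairmap.
    by rewrite size_map size_iota.
  move=> iw.
  by rewrite (nth_pairmap 0) // (nth_map 0) ?size_iota // nth_iota.
by rewrite count_map; apply: eq_count.
Qed.

Definition stats w := (asc w, des w, plat w).

Lemma statsE w : stats w =
  (cyclic_count 0 ltn (0 :: w), cyclic_count 0 gtn (0 :: w),
   cyclic_count 0 (@eq_op nat) (0 :: w)).
Proof. by rewrite -!card_letter_pairs. Qed.

Lemma mem_qstirling_words M w :
  reflect (noncrossing w /\ perm_eq w M) (w \in qstirling_words M).
Proof.
rewrite mem_filter mem_permutations.
by apply: (iffP andP) => -[/quasi_stirlingP]; split.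
Qed.

Lemma qstirling_words_uniq M : uniq (qstirling_words M).
Proof. exact/filter_uniq/permutations_uniq. Qed.

(** * Comparing the numbers of words with given statistics *)

(** An injection in relational form: [shift] acts on circles, so between words it
    is more easily described by a relation than by a function. *)
Lemma leq_size_relation (S T : eqType) (R : S -> T -> Prop) (s : seq S) (t : seq T) :
  uniq s -> {in s, forall x, exists2 y, y \in t & R x y} ->
  (forall x x' y, R x y -> R x' y -> x = x') -> size s <= size t.
Proof.
move=> us tot inj; elim: s t us tot => [|x s IH] t //= /andP[nxs us] tot.
have [y yt Rxy] := tot x (mem_head _ _).
have {IH} := IH (rem y t) us.
rewrite size_rem // => IH; case: t yt tot IH => [//|y0 t] _ tot IH.
rewrite ltnS; apply: IH => x' x's; have [|y' y't Rx'y'] := tot x'.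
  by rewrite inE x's orbT.
exists y' => //; have := y't; have : y' != y.
  by apply: contraNneq nxs => Ey; rewrite (inj x x' y) // -Ey.
by move=> ny yt; rewrite rem_mem.
Qed.

Lemma noncrossing_cons0 w : 0 \notin w -> noncrossing (0 :: w) <-> noncrossing w.
Proof.
move=> n0; split; first exact/noncrossing_subseq/subseq_cons.
move=> nc; apply: (@noncrossing_insert _ [::] [:: 0] w) => //.
  by move=> x; rewrite inE => /eqP ->.
by move=> x y _; apply/negP => /size_subseq.
Qed.

Definition adjacent (a b : nat) := (a == b.+1) || (b == a.+1).

(** Close 0w into a circle, cut it canonically, shift, and cut the result at its
    unique 0. The two words can be recovered from each other because both the
    canonical cut and the cut at 0 are unique. *)
Lemma move_copy_leq a b M M' v : adjacent a b -> 0 \notin M -> 0 \notin M' ->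
  a \in M' -> b \in M -> perm_eq (b :: M) (a :: M') ->
  count (fun w => stats w == v) (qstirling_words M) <=
  count (fun w => stats w == v) (qstirling_words M').
Proof.
move=> adj M0 M'0 aM' bM pM; rewrite -!size_filter.
have nab : a != b by move: adj; rewrite /adjacent; lia.
have a0 : a != 0 by apply: contraNneq M'0 => <-.
have b0 : b != 0 by apply: contraNneq M0 => <-.
pose R w w' := 0 \notin w /\ exists c d, [/\ canonical a b c, shift a b c d,
  is_rotation (0 :: w) c & is_rotation d (0 :: w')].
apply: (leq_size_relation _ _ R).
- exact/filter_uniq/qstirling_words_uniq.
- move=> w; rewrite mem_filter => /andP[/eqP stw /mem_qstirling_words[ncw pw]].
  have w0 : 0 \notin w by rewrite (perm_mem pw).
  have aM : count_mem a M = (count_mem a M').+1.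
    by have /permP/(_ (pred1 a)) := pM; rewrite /= eqxx [b == a]eq_sym (negPf nab).
  have cntw : count_mem a (0 :: w) = (count_mem a M').+1.
    by rewrite /= [0 == a]eq_sym (negPf a0) (permP pw).
  have aw : a \in 0 :: w by rewrite -has_pred1 has_count cntw.
  have bw : b \in 0 :: w by rewrite inE (perm_mem pw) bM orbT.
  have [|c canc rotc] := canonical_rotation_exists nab _ aw bw.
    exact/noncrossing_cons0.
  have pc := is_rotation_perm rotc.
  have [|d shd] := shift_exists nab canc.
    by rewrite -(permP pc) cntw ltnS -has_count has_pred1.
  have pd := shift_perm shd.
  have d0 : 0 \in d.
    have : 0 \in a :: d by rewrite -(perm_mem pd) inE -(perm_mem pc) mem_head orbT.
    by rewrite inE eq_sym (negPf a0).
  have [w' rotd] := is_rotation_to d0.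
  have pw' : perm_eq w' M'.
    apply/permP => e; have /permP/(_ e) := pM; have /permP/(_ e) := pd.
    have /permP/(_ e) := pc; have /permP/(_ e) := pw.
    have /permP/(_ e) := is_rotation_perm rotd; clear => /=; lia.
  have cyc (r : rel nat) : r a a = r b b ->
      (forall x, x != a -> x != b -> r a x = r b x /\ r x a = r x b) ->
      cyclic_count 0 r (0 :: w') = cyclic_count 0 r (0 :: w).
    move=> raa rab; rewrite -(cyclic_count_rotation 0 r rotd).
    by rewrite -(shift_cyclic_count 0 r raa rab shd) (cyclic_count_rotation 0 r rotc).
  exists w'; last by split=> //; exists c, d.
  rewrite mem_filter; apply/andP; split; last first.
    apply/mem_qstirling_words; split=> //; apply/noncrossing_cons0.
      by rewrite (perm_mem pw').
    apply: is_rotation_noncrossing rotd _; apply: shift_noncrossing shd _ => //.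
    by apply: is_rotation_noncrossing rotc _; apply/noncrossing_cons0.
  by rewrite -stw !statsE !cyc //; move: adj; clear; rewrite /adjacent /=; lia.
move=> w1 w2 w' [n1 [c1 [d1 [can1 sh1 rc1 rd1]]]] [n2 [c2 [d2 [can2 sh2 rc2 rd2]]]].
have Ed : d1 = d2.
  apply: (canonical_rotation_uniq nab) (shift_canonical nab can1 sh1) _ _.
    exact: shift_canonical can2 sh2.
  exact: is_rotation_trans rd1 (is_rotation_sym rd2).
rewrite -Ed in sh2; have Ec := shift_inj nab sh1 sh2.
apply: (is_rotation_head_uniq n1); rewrite -Ec in rc2.
exact: is_rotation_trans rc1 (is_rotation_sym rc2).
Qed.

Definition equistat M M' :=
  perm_eq (map stats (qstirling_words M)) (map stats (qstirling_words M')).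

(** Both inequalities come from [move_copy_leq], since its hypotheses are
    symmetric: a in M' and b in M say that M has a second a and M' a second b. *)
Lemma move_copy a b M M' : adjacent a b -> 0 \notin M -> 0 \notin M' ->
  a \in M' -> b \in M -> perm_eq (b :: M) (a :: M') -> equistat M M'.
Proof.
move=> adj M0 M'0 aM' bM pM; apply/allP => v _ /=; rewrite !count_map.
rewrite eqn_leq; apply/andP; split; first exact: move_copy_leq adj _ _ _ _ _.
by apply: (@move_copy_leq b a); rewrite // 1?perm_sym // /adjacent orbC.
Qed.

(** * Reaching a common composition *)

Fixpoint multiset_from k (s : seq nat) : seq nat :=
  if s is m :: s' then nseq m k ++ multiset_from k.+1 s' else [::].

Lemma multiset_from_cat k s t :
  multiset_from k (s ++ t) = multiset_from k s ++ multiset_from (k + size s) t.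
Proof.
by elim: s k => [|m s IH] k /=; rewrite ?addn0 // IH catA addSnnS.
Qed.

Lemma multiset_from_notin k s x : x < k -> x \notin multiset_from k s.
Proof.
elim: s k => //= m s IH k xk; rewrite mem_cat negb_or mem_nseq IH ?leqW // andbT.
by rewrite negb_and (ltn_eqF xk) orbT.
Qed.

Lemma comp_multisetE n (sigma : n.-tuple nat) :
  comp_multiset sigma = multiset_from 1 sigma.
Proof.
rewrite /comp_multiset.
have -> : [seq nseq (tnth sigma i) i.+1 | i : 'I_n <- enum 'I_n] =
          [seq nseq (nth 0 sigma i) i.+1 | i <- iota 0 n].
  rewrite -val_enum_ord -map_comp; apply: eq_map => i /=.
  by rewrite (tnth_nth 0).
rewrite -[X in iota 0 X](size_tuple sigma) -[1]add1n.
have gen (s : seq nat) k :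
    flatten [seq nseq (nth 0 s i) (k + i).+1 | i <- iota 0 (size s)]
    = multiset_from (1 + k) s.
  elim: s k => //= m s IH k; rewrite addn0 -IH; congr (_ ++ flatten _).
  rewrite -[1]addn0 iotaDl -map_comp; apply: eq_map => i /=.
  by rewrite add1n addnS addSn.
by rewrite -gen.
Qed.

Lemma equistat_move_to_left u v x y :
  equistat (multiset_from 1 (u ++ x.+1 :: y.+1 :: v))
           (multiset_from 1 (u ++ (x + y).+1 :: 1 :: v)).
Proof.
elim: y x => [|y IH] x; first by rewrite addn0; exact: perm_refl.
apply: (perm_trans _ (_ : equistat (multiset_from 1 (u ++ x.+2 :: y.+1 :: v)) _)).
  apply: (@move_copy (1 + size u).+1 (1 + size u)); rewrite ?multiset_from_notin //.
  - by rewrite /adjacent eqxx.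
  - by rewrite multiset_from_cat mem_cat /= !(inE, mem_cat) eqxx !orbT.
  - by rewrite multiset_from_cat mem_cat /= !(inE, mem_cat) eqxx !orbT.
  apply/permP => e; rewrite /= !multiset_from_cat /= !count_cat /=.
  rewrite !count_cat !count_nseq /=.
  rewrite !count_cat !count_nseq; lia.
by rewrite addnS -addSn; apply: IH.
Qed.

(** From right to left, each part hands all its copies but one to its left
    neighbour. *)
Lemma equistat_collapse_left u m s : all (leq 1) (m :: s) ->
  equistat (multiset_from 1 (u ++ m :: s))
    (multiset_from 1 (u ++ (sumn (m :: s) - size s) :: nseq (size s) 1)).
Proof.
elim: s u m => [|m' s IH] u [//|m] //=.
  by rewrite addn0 subn0 => _; exact: perm_refl.
case: m' => [|m'] // pos.
have := IH (rcons u m.+1) m'.+1 pos; rewrite !cat_rcons => /perm_trans; apply.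
have ge : size s <= m' + sumn s.
  apply: leq_trans (leq_addl _ _); elim: (s) (pos) => //= x s' IHs /andP[x0 ps].
  by rewrite -add1n; apply: leq_add => //; apply: IHs.
have -> : sumn (m'.+1 :: s) - size s = (m' + sumn s - size s).+1 by rewrite /=; lia.
have -> : m.+1 + (m'.+1 + sumn s) - (size s).+1 = (m + (m' + sumn s - size s)).+1 by lia.
exact: equistat_move_to_left.
Qed.

Lemma equistat_compositions K n (sigma tau : n.-tuple nat) :
  is_composition K sigma -> is_composition K tau ->
  equistat (comp_multiset sigma) (comp_multiset tau).
Proof.
rewrite /is_composition !comp_multisetE.
case: sigma tau => [s /= /eqP ss] [t /= /eqP st] /andP[ps /eqP Ks] /andP[pt /eqP Kt].
case: s ss ps Ks => [|m s] ss ps Ks.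
  by move: ss st => /= <- /size0nil ->; exact: perm_refl.
case: t st pt Kt => [|m' t] st pt Kt; first by rewrite -st in ss.
have := equistat_collapse_left [::] m s ps; have := equistat_collapse_left [::] m' t pt.
have -> : size t = size s by move: st ss => /= <- [].
rewrite Ks Kt /equistat perm_sym => H /perm_trans; apply; exact: H.
Qed.

(** * Bijections from equality of statistics *)

Lemma bijection_of_perm_map {T U : eqType} {h : T -> U} {s t : seq T} :
  uniq s -> uniq t -> perm_eq (map h s) (map h t) ->
  exists f : {x | x \in s} -> {x | x \in t},
    bijective f /\ forall x, h (sval (f x)) = h (sval x).
Proof.
case: s => [|x0 s0].
  move=> _ _ /perm_size/esym/eqP; rewrite size_map size_eq0 => /eqP ->.
  by exists id; split=> //; exists id.
move: (x0 :: s0) => {s0}s us ut /(perm_iotaP (h x0))[I pI EI].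
(* Reorder t as t' so that it lists the same values of h as s, then match positions. *)
pose t' := map (nth x0 t) I.
have pt' : perm_eq t' t.
  apply: (perm_trans (perm_map _ pI)); rewrite size_map.
  by rewrite -[X in perm_eq _ X](mkseq_nth x0).
have ht' : map h t' = map h s.
  rewrite EI -map_comp; apply/eq_in_map => i.
  rewrite (perm_mem pI) mem_iota size_map /= => it.
  by rewrite (nth_map x0).
have sz : size t' = size s by rewrite -(size_map h t') ht' size_map.
have ut' : uniq t' by rewrite (perm_uniq pt').
have F (x : {x | x \in s}) : nth x0 t' (index (sval x) s) \in t.
  by rewrite -(perm_mem pt') mem_nth // sz index_mem (svalP x).
have G (y : {y | y \in t}) : nth x0 s (index (sval y) t') \in s.
  by rewrite mem_nth // -sz index_mem (perm_mem pt') (svalP y).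
exists (fun x => exist (fun y => y \in t) _ (F x)); split.
  exists (fun y => exist (fun x => x \in s) _ (G y)) => -[x xP]; apply/val_inj => /=.
    by rewrite index_uniq ?nth_index // sz index_mem.
  have yt' : x \in t' by rewrite (perm_mem pt').
  by rewrite index_uniq ?nth_index // -sz index_mem.
move=> [x xs] /=; rewrite -(nth_map _ (h x0)) ?sz ?index_mem // ht'.
by rewrite (nth_map x0) ?index_mem // nth_index.
Qed.

Theorem theorem1p2 (K n : nat) (hK : 0 < K) (hn : 0 < n)
    (sigma tau : n.-tuple nat)
    (hsigma : is_composition K sigma) (htau : is_composition K tau) :
  (exists f : {w : seq nat | w \in qstirling_words (comp_multiset sigma)} ->
              {w : seq nat | w \in qstirling_words (comp_multiset tau)},
     bijective f /\
     (forall w, [/\ asc (sval (f w)) = asc (sval w),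
                    des (sval (f w)) = des (sval w)
                  & plat (sval (f w)) = plat (sval w)])) /\
  qstirling_poly (comp_multiset sigma) = qstirling_poly (comp_multiset tau).
Proof.
have eqst := equistat_compositions _ _ _ _ hsigma htau.
split.
  have [f [bf hf]] := bijection_of_perm_map
    (qstirling_words_uniq _) (qstirling_words_uniq _) eqst.
  by exists f; split=> // w; case: (hf w).
pose m (x : nat * nat * nat) : {mpoly int[3]} :=
  ('X_(inord 0) ^+ x.1.2 * 'X_(inord 1) ^+ x.1.1 * 'X_(inord 2) ^+ x.2)%R.
have polyE M : qstirling_poly M = (\sum_(x <- map stats (qstirling_words M)) m x)%R.
  by rewrite big_map.
by rewrite !polyE; apply: perm_big.
Qed.
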